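(* Let $k \geq 2$, $p \geq 2$ and $0 \leq r < p$ be integers. Let $d_{p}(n,k,r)$ be the number of partitions of $n$ in which exactly one part congruent to $r \pmod{p}$ appears at least $k$ times (every other part congruent to $r \pmod p$ appears at most $k-1$ times), while parts not congruent to $r \pmod{p}$ appear with unrestricted multiplicity. Let $f_{p}(n,k,r)$ be the number of partitions of $n$ in which the set of (distinct values of) parts congruent to $kr \pmod{pk}$ has exactly one element (other parts unrestricted). Then for every integer $n \geq 1$, $$f_{p}(n,k,r) = d_{p}(n,k,r).$$ *)

(* Defs.v *)
From mathcomp Require Import all_boot.

Set Implicit Arguments.
Unset Strict Implicit.
Unset Printing Implicit Defensive.

Definition is_partition (n : nat) (s : seq nat) : bool :=
  [&& sorted geq s, 0 \notin s & sumn s == n].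

(* A partition of n has at most n parts, each at most n, so the partitions of n
   all live in the finite type of sequences of length <= n over {0, ..., n};
   lemma is_partition_bseq below shows that none is lost. *)
Definition nb_partitions (n : nat) (P : pred (seq nat)) : nat :=
  #|[set t : {bseq n of 'I_n.+1} | is_partition n (map val t) & P (map val t)]|.

Lemma is_partition_bseq (n : nat) (s : seq nat) :
  is_partition n s -> exists t : {bseq n of 'I_n.+1}, map val t = s.
Proof.
case/and3P=> _ s0 /eqP sn.
have sz : size s <= n.
  rewrite -sn; elim: s s0 {sn} => //= x s IHs.
  rewrite inE negb_or eq_sym -lt0n => /andP[x0 s0].
  by rewrite -add1n leq_add // IHs.
have le_n : all (fun i => i < n.+1) s.
  apply/allP=> i si; rewrite ltnS -sn.
  by rewrite sumnE (big_rem i) //= leq_addr.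
have szt : size (map (@inord n) s) <= n by rewrite size_map.
exists (Bseq szt) => /=; rewrite -map_comp -[RHS]map_id.
by apply/eq_in_map=> i /(allP le_n) /= lt_i; rewrite inordK.
Qed.

Definition d_count (p n k r : nat) : nat :=
  nb_partitions n (fun s =>
    count (fun i => (i == r %[mod p]) && (k <= count_mem i s)) (undup s) == 1).

Definition f_count (p n k r : nat) : nat :=
  nb_partitions n (fun s =>
    size (undup [seq i <- s | i == k * r %[mod p * k]]) == 1).

(* Main.v *)
(** Attach to a partition s the set D s of its parts a = r mod p of multiplicity
    at least k, and the set F s of those a = r mod p such that k * a is a part;
    the parts congruent to k * r mod p * k are exactly these k * a. Replacing,
    for every a in A, k copies of a by one copy of k * a is a bijection from
    the partitions with A \subset D s onto those with A \subset F s. By Moebius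
    inversion over A, the statistics D and F are equidistributed; d_count and
    f_count count the partitions with #|D s| = 1 and #|F s| = 1. *)

Require Import Defs.
From mathcomp Require Import all_boot.

Set Implicit Arguments.
Unset Strict Implicit.
Unset Printing Implicit Defensive.

Lemma geq_trans : transitive geq.
Proof. by move=> y x z xy yz; apply: leq_trans yz xy. Qed.

Lemma geq_total : total geq.
Proof. by move=> x y; apply: leq_total. Qed.

Lemma geq_anti : antisymmetric geq.
Proof. by move=> x y; rewrite /geq andbC => /anti_leq. Qed.

(** * Inversion over the subsets of a finite set *)

Section EquidistributedSets.

Variables (T I : finType) (X : {set T}).

Lemma card_fiber_pred (D : T -> {set I}) (P : pred {set I}) :
  #|[set t in X | P (D t)]| = \sum_(B | P B) #|[set t in X | D t == B]|.
Proof.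
rewrite -sum1_card (partition_big D P) /=; last by move=> t; rewrite inE => /andP[].
apply: eq_bigr => B PB; rewrite -sum1_card; apply: eq_bigl => t.
by rewrite !inE; case: eqP => [->|]; rewrite ?PB ?andbT ?andbF.
Qed.

(** No alternating sum is needed. The hypothesis at [A] equates two sums of fiber sizes over all [B]
    containing [A]. By induction on the size of the complement of [A], the terms with [B] strictly
    larger agree, and cancelling them leaves the term at [A]. *)
Lemma card_fiber_eq (D F : T -> {set I}) :
    (forall A : {set I}, #|[set t in X | A \subset D t]| =
                         #|[set t in X | A \subset F t]|) ->
  forall A : {set I}, #|[set t in X | D t == A]| = #|[set t in X | F t == A]|.
Proof.
move=> DF A; have [m] := ubnP #|~: A|; elim: m A => // m IHm A le_m.
move: (DF A); rewrite !(@card_fiber_pred _ (fun B : {set I} => A \subset B)).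
rewrite (bigD1 A) //= [RHS](bigD1 A) //=.
rewrite (eq_bigr (fun B => #|[set t in X | F t == B]|)).
  by move/addIn.
move=> B /andP[AB nBA]; apply: IHm; rewrite -ltnS; apply: leq_trans le_m; rewrite ltnS.
apply: proper_card; rewrite properEneq setCS AB andbT.
by rewrite (inj_eq (can_inj (@setCK _))).
Qed.

End EquidistributedSets.

(** * Exchanging one sub-multiset of parts for another *)

Definition mset_le (M s : seq nat) : bool :=
  all (fun x => count_mem x M <= count_mem x s) M.

Lemma mset_leP (M s : seq nat) :
  reflect (forall x, count_mem x M <= count_mem x s) (mset_le M s).
Proof.
apply: (iffP allP) => [le_Ms x | le_Ms x _ //].
by have [/le_Ms // | /count_memPn ->] := boolP (x \in M).
Qed.

Lemma count_mem_foldr_rem (x : nat) (s M : seq nat) :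
  count_mem x (foldr (fun y => rem y) s M) = count_mem x s - count_mem x M.
Proof.
elim: M => [|y M IHM] /=; first by rewrite subn0.
by rewrite count_mem_rem IHM -subnDA addnC.
Qed.

Lemma perm_foldr_rem (M s : seq nat) :
  mset_le M s -> perm_eq s (M ++ foldr (fun y => rem y) s M).
Proof.
move/mset_leP=> le_Ms; apply/allP=> x _ /=.
by rewrite count_cat count_mem_foldr_rem subnKC.
Qed.

(** Sorting picks the one representative of the new multiset that [is_partition] accepts; the fold
    of [rem] is the multiset difference of [s] and [M]. *)
Definition exchange (M M' s : seq nat) : seq nat :=
  sort geq (M' ++ foldr (fun y => rem y) s M).

(** The sum does not detect zeros, hence the separate condition on [0]: as [s] contains [M] but not
    [0], it keeps [0] out of [M']. *)
Lemma exchange_partition (n : nat) (M M' s : seq nat) :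
    sumn M = sumn M' -> (0 \in M) = (0 \in M') -> mset_le M s ->
  is_partition n s -> is_partition n (exchange M M' s) /\ mset_le M' (exchange M M' s).
Proof.
move=> eq_sum eq0 /perm_foldr_rem; set u := foldr _ _ _ => perm_s.
case/and3P=> _ s0 /eqP sum_s; split; last first.
  by apply/mset_leP=> x; rewrite (permP (permEl (perm_sort _ _))) count_cat leq_addr.
apply/and3P; split; first exact/sort_sorted/geq_total.
  by rewrite mem_sort mem_cat -eq0 -mem_cat -(perm_mem perm_s).
rewrite (perm_sumn (permEl (perm_sort _ _))) sumn_cat -eq_sum -sumn_cat.
by rewrite -(perm_sumn perm_s) sum_s.
Qed.

Lemma exchange_inj (n : nat) (M M' s t : seq nat) :
    is_partition n s -> is_partition n t -> mset_le M s -> mset_le M t ->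
  exchange M M' s = exchange M M' t -> s = t.
Proof.
case/and3P=> sorted_s _ _ /and3P[sorted_t _ _] Ms Mt eq_st.
apply: (sorted_eq geq_trans geq_anti) => //.
rewrite (permPl (perm_foldr_rem Ms)) perm_sym (permPl (perm_foldr_rem Mt)).
(* Cancel the common [M], then add [M'] on both sides to recognise the two exchanges. *)
rewrite perm_cat2l -(perm_cat2l M') -(perm_sort geq) perm_sym -(perm_sort geq).
by rewrite -!/(exchange _ _ _) eq_st.
Qed.

Lemma leq_nb_partitions (n : nat) (P Q : pred (seq nat)) (g : seq nat -> seq nat) :
    (forall s, is_partition n s -> P s -> is_partition n (g s) /\ Q (g s)) ->
    (forall s t, is_partition n s -> P s -> is_partition n t -> P t ->
       g s = g t -> s = t) ->
  nb_partitions n P <= nb_partitions n Q.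
Proof.
move=> gPQ g_inj; rewrite /nb_partitions !cardE.
set A := [set t | _ & P _]; set B := [set t | _ & Q _].
rewrite -(size_map (fun t => g (map val (val t))) (enum A)).
rewrite -(size_map (fun t => map val (val t)) (enum B)).
apply: uniq_leq_size.
  rewrite map_inj_in_uniq ?enum_uniq // => s t.
  rewrite !mem_enum !inE => /andP[ps Ps] /andP[pt Pt] /(g_inj _ _ ps Ps pt Pt).
  by move/(inj_map val_inj)/val_inj.
move=> _ /mapP[s + ->]; rewrite mem_enum inE => /andP[ps Ps].
have [pg Qg] := gPQ _ ps Ps; have [t def_t] := is_partition_bseq pg.
by apply/mapP; exists t; rewrite // mem_enum inE def_t pg.
Qed.

(** Injections in both directions give the equality, so the two exchanges need not be shown mutually
    inverse. *)
Lemma nb_partitions_exchange (n : nat) (M M' : seq nat) :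
    sumn M = sumn M' -> (0 \in M) = (0 \in M') ->
  nb_partitions n (mset_le M) = nb_partitions n (mset_le M').
Proof.
move=> eq_sum eq0; apply/eqP; rewrite eqn_leq; apply/andP; split.
  apply: (@leq_nb_partitions _ _ _ (exchange M M')) => [s ps Ms | s t ps Ms pt Mt].
    exact: exchange_partition.
  exact: exchange_inj ps pt Ms Mt.
apply: (@leq_nb_partitions _ _ _ (exchange M' M)) => [s ps Ms | s t ps Ms pt Mt].
  exact: exchange_partition.
exact: exchange_inj ps pt Ms Mt.
Qed.

Lemma partition_part_bounds (n i : nat) (s : seq nat) :
  is_partition n s -> i \in s -> 0 < i < n.+1.
Proof.
case/and3P=> _ s0 /eqP <- si; rewrite lt0n ltnS sumnE (big_rem i) //= leq_addr.
by rewrite andbT; apply: contraNneq s0 => <-.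
Qed.

(** * The sets of repeated parts and of multiples of [k] *)

Section Statistics.

Variables (k p r n : nat).
Hypothesis k_gt0 : 0 < k.

Definition repeated_set (s : seq nat) : {set 'I_n.+1} :=
  [set a : 'I_n.+1 | (a == r %[mod p]) && (k <= count_mem (val a) s)].

Definition multiple_set (s : seq nat) : {set 'I_n.+1} :=
  [set a : 'I_n.+1 | (a == r %[mod p]) && (k * a \in s)].

Definition repeated_parts (A : {set 'I_n.+1}) : seq nat :=
  flatten [seq nseq k (val a) | a <- enum A].

Definition multiple_parts (A : {set 'I_n.+1}) : seq nat :=
  [seq k * val a | a <- enum A].

Lemma sumn_repeated_parts (A : {set 'I_n.+1}) :
  sumn (repeated_parts A) = sumn (multiple_parts A).
Proof.
rewrite /repeated_parts /multiple_parts.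
by elim: (enum A) => //= a e IHe; rewrite sumn_cat sumn_nseq IHe mulnC.
Qed.

(** The index type includes [0], so [A] may contain it; since [k] is positive, [0] then lies in both
    lists. *)
Lemma mem0_repeated_parts (A : {set 'I_n.+1}) :
  (0 \in repeated_parts A) = (0 \in multiple_parts A).
Proof.
rewrite /repeated_parts /multiple_parts.
elim: (enum A) => //= a e IHe; rewrite mem_cat inE IHe mem_nseq k_gt0.
by rewrite ![0 == _]eq_sym muln_eq0 (gtn_eqF k_gt0).
Qed.

Lemma count_repeated_parts (A : {set 'I_n.+1}) (x : nat) :
  count_mem x (repeated_parts A) = k * (x \in [seq val a | a <- enum A]).
Proof.
rewrite -count_uniq_mem ?(map_inj_uniq val_inj) ?enum_uniq // /repeated_parts.
elim: (enum A) => [|a e IHe] /=; first by rewrite muln0.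
by rewrite count_cat count_nseq IHe mulnDr mulnC.
Qed.

Lemma mset_le_repeated_parts (A : {set 'I_n.+1}) (s : seq nat) :
  mset_le (repeated_parts A) s = [forall a in A, k <= count_mem (val a) s].
Proof.
apply/mset_leP/forall_inP => [le_As a Aa | le_As x].
  have := le_As (val a); rewrite count_repeated_parts mem_map; last exact: val_inj.
  by rewrite mem_enum Aa muln1.
rewrite count_repeated_parts; case: mapP => [[a]|_]; last by rewrite muln0.
by rewrite mem_enum muln1 => /le_As + ->.
Qed.

Lemma mset_le_multiple_parts (A : {set 'I_n.+1}) (s : seq nat) :
  mset_le (multiple_parts A) s = [forall a in A, k * a \in s].
Proof.
(* Multiplication by [k] is injective, so the list has no repetition and multiset inclusion reduces
   to membership. *)
have uniq_A : uniq (multiple_parts A).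
  rewrite map_inj_uniq ?enum_uniq // => a b /eqP.
  by rewrite eqn_pmul2l // => /eqP/val_inj.
apply/allP/forall_inP => [le_As a Aa | le_As x Ax].
  have Aka : k * a \in multiple_parts A by apply/mapP; exists a; rewrite ?mem_enum.
  by have := le_As _ Aka; rewrite count_uniq_mem // Aka -has_count has_pred1.
rewrite count_uniq_mem // Ax -has_count has_pred1.
by case/mapP: Ax => a; rewrite mem_enum => /le_As + ->.
Qed.

Lemma nb_partitions_supset (A : {set 'I_n.+1}) :
  nb_partitions n (fun s => A \subset repeated_set s) =
  nb_partitions n (fun s => A \subset multiple_set s).
Proof.
have subE (Q : pred 'I_n.+1) : (A \subset [set a : 'I_n.+1 | (a == r %[mod p]) && Q a])
    = [forall a in A, a == r %[mod p]] && [forall a in A, Q a].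
  apply/subsetP/andP => [sub | [/forall_inP Ar /forall_inP AQ] a Aa].
    by split; apply/forall_inP=> a /sub; rewrite inE => /andP[].
  by rewrite inE Ar ?AQ.
(* If some element of [A] is not congruent to [r], neither inclusion can hold and both counts
   vanish. *)
case Ar: [forall a in A, a == r %[mod p]]; last first.
  by apply: eq_card => t; rewrite !inE !subE Ar.
have := @nb_partitions_exchange n _ _ (sumn_repeated_parts A) (mem0_repeated_parts A).
rewrite /nb_partitions => eq_card_le.
transitivity #|[set t : {bseq n of 'I_n.+1} | is_partition n (map val t)
                 & mset_le (repeated_parts A) (map val t)]|.
  by apply: eq_card => t; rewrite !inE subE Ar mset_le_repeated_parts.
rewrite eq_card_le.
by apply: eq_card => t; rewrite !inE subE Ar mset_le_multiple_parts.
Qed.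

Lemma count_repeated_set (s : seq nat) : is_partition n s ->
  count (fun i => (i == r %[mod p]) && (k <= count_mem i s)) (undup s) =
  #|repeated_set s|.
Proof.
move=> ps; rewrite -size_filter cardE -(size_map val).
apply/perm_size/uniq_perm; rewrite ?filter_uniq ?undup_uniq //.
  by rewrite (map_inj_uniq val_inj) enum_uniq.
move=> i; rewrite mem_filter mem_undup; apply/andP/mapP.
  case=> Pi /(partition_part_bounds ps)/andP[_ lt_i].
  by exists (Ordinal lt_i); rewrite // mem_enum inE.
case=> a; rewrite mem_enum inE => Pa ->; split=> //.
by case/andP: Pa => _ /(leq_trans k_gt0); rewrite -has_count has_pred1.
Qed.

Lemma eqn_mod_mulr (a : nat) : (k * a == k * r %[mod p * k]) = (a == r %[mod p]).
Proof. by rewrite [p * k]mulnC -!muln_modr eqn_pmul2l. Qed.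

Lemma size_multiple_set (s : seq nat) : is_partition n s ->
  size (undup [seq i <- s | i == k * r %[mod p * k]]) = #|multiple_set s|.
Proof.
move=> ps; rewrite cardE -(size_map (fun a : 'I_n.+1 => k * a)).
apply/perm_size/uniq_perm; rewrite ?undup_uniq //.
  rewrite map_inj_uniq ?enum_uniq // => a b /eqP.
  by rewrite eqn_pmul2l // => /eqP/val_inj.
move=> i; rewrite mem_undup mem_filter; apply/andP/mapP.
  case=> eq_i si.
  (* Reduce the congruence modulo [p * k] further modulo [k], where [k * r] becomes [0]. *)
  have /dvdnP[a def_i] : k %| i.
    have : i = k * r %[mod k].
      by rewrite -(modn_dvdm i (dvdn_mull p (dvdnn k))) (eqP eq_i) modn_dvdm ?dvdn_mull.
    by move/eqP; rewrite modnMr.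
  have /andP[_] := partition_part_bounds ps si; rewrite {1}def_i => lt_ak.
  (* The quotient [a] is at most the part [a * k], so it is a valid index. *)
  have lt_a : a < n.+1 by apply: leq_ltn_trans lt_ak; rewrite leq_pmulr.
  exists (Ordinal lt_a); last by rewrite /= mulnC.
  by rewrite mem_enum inE /= -eqn_mod_mulr mulnC -def_i eq_i.
by case=> a; rewrite mem_enum inE => /andP[eq_a sa] ->; rewrite eqn_mod_mulr.
Qed.

End Statistics.

Theorem theorem6 (k p r n : nat) (hk : 2 <= k) (hp : 2 <= p) (hr : r < p)
    (hn : 1 <= n) :
  f_count p n k r = d_count p n k r.
Proof.
have k_gt0 : 0 < k by apply: ltnW.
pose X := [set t : {bseq n of 'I_n.+1} | is_partition n (map val t)].
have setE (P : pred (seq nat)) : nb_partitions n P = #|[set t in X | P (map val (val t))]|.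
  by apply: eq_card => t; rewrite !inE.
pose D (t : {bseq n of 'I_n.+1}) := repeated_set k p r n (map val t).
pose F (t : {bseq n of 'I_n.+1}) := multiple_set k p r n (map val t).
have DF (A : {set 'I_n.+1}) :
    #|[set t in X | A \subset D t]| = #|[set t in X | A \subset F t]|.
  by have := @nb_partitions_supset k p r n k_gt0 A; rewrite !setE.
transitivity #|[set t in X | #|F t| == 1]|.
  rewrite /f_count setE; apply: eq_card => t; rewrite !inE.
  by case ps: is_partition; rewrite //= (@size_multiple_set _ _ _ n).
transitivity #|[set t in X | #|D t| == 1]|; last first.
  rewrite /d_count setE; apply: eq_card => t; rewrite !inE.
  by case ps: is_partition; rewrite //= (@count_repeated_set _ _ _ n).
(* Split both counts over the possible singletons [B]; the fibers of [F] and [D] over each [B] have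
   equal size. *)
rewrite !(@card_fiber_pred _ _ X _ (fun B => #|B| == 1)).
by apply: eq_bigr => B _; rewrite (card_fiber_eq DF).
Qed.
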